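(* Assume the Continuum Hypothesis. Then there exists a maximal cofinitary group $G \le \mathrm{Sym}(\mathbb{N})$ such that every countable group embeds (as an abstract group) into $G$.
   Context: $\mathrm{Sym}(\mathbb{N})$ is the group of bijections $\mathbb{N}\to\mathbb{N}$ under composition. A permutation is cofinitary if it is the identity or has only finitely many fixed points. A subgroup of $\mathrm{Sym}(\mathbb{N})$ is cofinitary if all its elements are cofinitary, and maximal cofinitary if it is cofinitary and not properly contained in another cofinitary subgroup. *)

(* Defs.v *)
From Stdlib Require Import Classical FunctionalExtensionality.

Definition feq (f g : nat -> nat) : Prop := forall n, f n = g n.

Definition comp (f g : nat -> nat) : nat -> nat := fun n => f (g n).

Definition is_bij (f : nat -> nat) : Prop :=
  (forall m n, f m = f n -> m = n) /\ (forall m, exists n, f n = m).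

Definition is_subgroup_Sym (G : (nat -> nat) -> Prop) : Prop :=
  (forall f g, feq f g -> G f -> G g) /\
  (forall f, G f -> is_bij f) /\
  G (fun n => n) /\
  (forall f g, G f -> G g -> G (comp f g)) /\
  (forall f, G f -> exists h, G h /\ feq (comp f h) (fun n => n)
                                  /\ feq (comp h f) (fun n => n)).

Definition finite_nat (P : nat -> Prop) : Prop := exists N, forall n, P n -> n < N.

Definition cofinitary (f : nat -> nat) : Prop :=
  feq f (fun n => n) \/ finite_nat (fun n => f n = n).

Definition cofinitary_group (G : (nat -> nat) -> Prop) : Prop :=
  is_subgroup_Sym G /\ forall f, G f -> cofinitary f.

Definition maximal_cofinitary_group (G : (nat -> nat) -> Prop) : Prop :=
  cofinitary_group G /\
  forall H : (nat -> nat) -> Prop,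
    cofinitary_group H -> (forall f, G f -> H f) -> forall f, H f -> G f.

Definition is_group (T : Type) (mul : T -> T -> T) (inv : T -> T) (e : T) : Prop :=
  (forall x y z, mul x (mul y z) = mul (mul x y) z) /\
  (forall x, mul e x = x) /\ (forall x, mul x e = x) /\
  (forall x, mul (inv x) x = e) /\ (forall x, mul x (inv x) = e).

Definition countable_type (T : Type) : Prop :=
  exists c : T -> nat, forall x y, c x = c y -> x = y.

Definition embeds_into (T : Type) (mul : T -> T -> T) (G : (nat -> nat) -> Prop) : Prop :=
  exists phi : T -> (nat -> nat),
    (forall x, G (phi x)) /\
    (forall x y, feq (phi (mul x y)) (comp (phi x) (phi y))) /\
    (forall x y, feq (phi x) (phi y) -> x = y).

Definition CH : Prop :=
  forall P : (nat -> bool) -> Prop,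
    countable_type {x : nat -> bool | P x} \/
    exists h : {x : nat -> bool | P x} -> (nat -> bool),
      (forall a b, h a = h b -> a = b) /\ (forall y, exists a, h a = y).

(* Main.v *)
(* Give every group law on nat, coded by [x : nat -> nat], the set [branch x] of
   codes of finite prefixes of [x]; these sets are pairwise almost disjoint.  A
   countable group with code [x] has a free action on nat in which every
   nontrivial element increases every point off [branch x].  Let a nontrivial
   cyclically reduced product of elements of several of these groups fix a point.
   The largest point p of the resulting cycle is not increased by the two
   neighbouring letters, which belong to distinct groups with codes x and y, so p
   lies in the finite set [branch x] /\ [branch y].  Hence there are finitely many
   such cycles: the groups together generate a cofinitary group, which Zorn's
   lemma extends to a maximal one. *)
From Stdlib Require List.
From mathcomp Require Import all_boot.
From mathcomp Require Import boolp classical_sets.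
Require Import Defs.

Set Implicit Arguments.
Unset Strict Implicit.
Unset Printing Implicit Defensive.

(** * Bounds and finite sets of natural numbers *)

Lemma eventually_all (A : Type) (s : seq A) (P : A -> nat -> Prop) :
  (forall a, List.In a s -> exists N, forall p, N <= p -> P a p) ->
  exists N, forall a, List.In a s -> forall p, N <= p -> P a p.
Proof.
elim: s => [|a s IHs] Ps; first by exists 0.
have [N1 H1] := Ps a (or_introl erefl).
have [N2 H2] := IHs (fun b sb => Ps b (or_intror sb)).
exists (maxn N1 N2) => b [<-|sb] p; rewrite geq_max => /andP[le1 le2].
  exact: H1.
exact: H2.
Qed.

Lemma argmax_below (F : nat -> nat) n :
  exists2 i, i <= n & forall j, j <= n -> F j <= F i.
Proof.
have [i _ iP] := @arg_maxnP 'I_n.+1 ord0 xpredT (fun i => F i) isT.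
exists i => [|j]; first by rewrite -ltnS.
by rewrite -ltnS => lt_jn; apply: (iP (Ordinal lt_jn)).
Qed.

Lemma finite_nat_preim (P : nat -> Prop) (g g' : nat -> nat) :
  cancel g g' -> finite_nat P -> finite_nat (fun n => P (g n)).
Proof.
move=> gK [N ltN]; exists (\max_(i < N) g' i).+1 => n Pgn.
have lt_gn : g n < N by apply/ltP/ltN.
by apply/ltP; rewrite ltnS -{1}(gK n) (leq_bigmax (Ordinal lt_gn)).
Qed.

(** The injective map [g] carries fixed points of [comp f g] to fixed points of [comp g f]. *)
Lemma cofinitary_swap (f g g' : nat -> nat) :
  cancel g g' -> cofinitary (comp g f) -> cofinitary (comp f g).
Proof.
move=> gK [gf1|fin]; [left=> n|right].
  exact/(can_inj gK)/gf1.
have [N ltN] := finite_nat_preim gK fin.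
by exists N => n fgn; apply: ltN; rewrite /comp -[in RHS]fgn.
Qed.

(** * Words in a family of permutation groups *)

Section Generation.

Variables (I : Type) (K : I -> (nat -> nat) -> Prop).

(** A letter keeps the index of its group, because reduction compares groups and one permutation may
    lie in several of them. *)
Definition letter (a : I * (nat -> nat)) : bool := `[< K a.1 a.2 >].

Definition eval (l : seq (I * (nat -> nat))) (z : nat) : nat :=
  foldr (fun a => a.2) z l.

Definition generated (f : nat -> nat) : Prop :=
  exists2 l, all letter l & f = eval l.

Hypothesis K_subgroup : forall x, is_subgroup_Sym (K x).

Lemma eval_cat l1 l2 z : eval (l1 ++ l2) z = eval l1 (eval l2 z).
Proof. exact: foldr_cat. Qed.

Lemma letter_comp x f g :
  letter (x, f) -> letter (x, g) -> letter (x, comp f g).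
Proof.
have [_ [_ [_ [KM _]]]] := K_subgroup x.
by move=> /asboolP Kf /asboolP Kg; apply/asboolP/KM.
Qed.

Lemma letter_inv x f : letter (x, f) ->
  exists h, [/\ letter (x, h), cancel f h & cancel h f].
Proof.
have [_ [_ [_ [_ KV]]]] := K_subgroup x.
by move=> /asboolP /KV [h [Kh [hK fK]]]; exists h; split=> //; apply/asboolP.
Qed.

Lemma eval_inv l : all letter l ->
  exists l', [/\ all letter l', cancel (eval l) (eval l') &
                 cancel (eval l') (eval l)].
Proof.
elim: l => [_|[x f] l IHl /= /andP[Kf Kl]]; first by exists [::].
have [l' [Kl' lK l'K]] := IHl Kl; have [h [Kh fK hK]] := letter_inv Kf.
exists (l' ++ [:: (x, h)]); split=> [|z|z].
- by rewrite all_cat Kl' /= Kh.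
- by rewrite eval_cat /= fK lK.
- by rewrite eval_cat /= l'K hK.
Qed.

Lemma generated_subgroup : is_subgroup_Sym generated.
Proof.
split; [|split; [|split; [|split]]].
- by move=> f g /funext <-.
- move=> f [l Kl ->]; have [l' [_ lK l'K]] := eval_inv Kl.
  by split=> [m n|m]; [apply: (can_inj lK) | exists (eval l' m)].
- by exists [::].
- move=> f g [l1 K1 ->] [l2 K2 ->]; exists (l1 ++ l2); first by rewrite all_cat K1.
  by apply/funext=> z; rewrite eval_cat.
- move=> f [l Kl ->]; have [l' [Kl' lK l'K]] := eval_inv Kl.
  by exists (eval l'); split; [exists l'|split=> z; [apply: l'K|apply: lK]].
Qed.

Lemma generated_sub x f : K x f -> generated f.
Proof. by move=> Kf; exists [:: (x, f)] => //=; rewrite andbT; apply/asboolP. Qed.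

Variable Q : I -> pred nat.

Hypothesis almost_disjoint : forall x y, x <> y ->
  exists N, forall p, N <= p -> ~~ (Q x p && Q y p).
Hypothesis K_free : forall x f, K x f -> f = id \/
  (forall i, f i <> i) /\ (forall i, ~~ Q x i -> i < f i).

(** In both cases [a] acts right after [b]; in the second, [b] ends one turn of the cycle and [a]
    starts the next. *)
Definition cyclically_adjacent (l : seq (I * (nat -> nat))) a b : Prop :=
  (exists l1 l2, l = l1 ++ a :: b :: l2) \/ (exists l1, l = b :: rcons l1 a).

Lemma cyclically_adjacent_In l a b :
  cyclically_adjacent l a b -> List.In a l /\ List.In b l.
Proof.
case=> [[l1 [l2 ->]]|[l1 ->]].
  by split; apply/List.in_or_app; right; [left|right; left].
split; last by left.
by right; rewrite -cats1; apply/List.in_or_app; right; left.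
Qed.

Lemma K_incr x f i : K x f -> f <> id -> ~~ Q x i -> i < f i.
Proof. by move=> /K_free[->|[_ +]]; [| move=> + _; apply]. Qed.

(* At the largest point p = b u of the cycle traced by a fixed point, both a and
   the inverse of b are non-increasing, so p lies in both marked sets. *)
Lemma cyclically_reduced_fix l : 1 < size l -> all letter l ->
  (forall a, List.In a l -> a.2 <> id) ->
  (forall a b, cyclically_adjacent l a b -> a.1 <> b.1) ->
  finite_nat (fun z => eval l z = z).
Proof.
move=> l_gt1 Kl l_nontriv l_red.
have [N NP] : exists N, forall a, List.In a l -> forall p, N <= p ->
    forall b, List.In b l -> a.1 <> b.1 -> ~~ (Q a.1 p && Q b.1 p).
  apply: eventually_all => a _.
  have [N NP] : exists N, forall b, List.In b l -> forall p, N <= p ->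
      a.1 <> b.1 -> ~~ (Q a.1 p && Q b.1 p).
    apply: eventually_all => b _; have [eq_ab|neq_ab] := EM (a.1 = b.1).
      by exists 0.
    by have [N NP] := almost_disjoint neq_ab; exists N => p /NP.
  by exists N => p leNp b lb; apply: NP.
exists N => z lz; apply/ltP; rewrite ltnNge; apply/negP => leNz.
pose F n := eval (drop n.+1 l) z.
have [n le_n Fmax] := argmax_below F (size l).-1.
(* [F n] is the point on which the letter at position [n] acts. *)
have szl : (size l).-1.+1 = size l by rewrite prednK // ltnW.
have Flast : F (size l).-1 = z by rewrite /F szl drop_size.
(* The cycle closes at [z], so [F n] also dominates the values at both ends of the word. *)
have bound m : eval (drop m l) z <= F n.
  case: m => [|m].
    by rewrite drop0 lz -[leqLHS]Flast; apply: Fmax.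
  have [le_m|lt_m] := leqP m (size l).-1; first exact: Fmax.
  rewrite drop_oversize; last by rewrite -szl ltnS ltnW.
  by rewrite -[leqLHS]Flast; apply: Fmax.
have leNF : N <= F n by apply: leq_trans leNz _; rewrite -[leqLHS]Flast Fmax.
have [a [b [u [ab_adj Fn le_u le_a]]]] : exists a b u,
    [/\ cyclically_adjacent l a b, F n = b.2 u, u <= F n & a.2 (F n) <= F n].
  have szD := size_drop n l; have bound0 := bound n; have bound2 := bound n.+2.
  have ltn : n < size l by rewrite -szl ltnS.
  have dropS : drop n.+1 l = behead (drop n l) by rewrite -drop1 drop_drop add1n.
  have dropSS : drop n.+2 l = behead (behead (drop n l)).
    by rewrite -dropS -drop1 drop_drop add1n.
  rewrite /F dropS; rewrite /F ?dropSS dropS in bound0 bound2.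
  case def_d: (drop n l) => [|a [|b w]] in szD bound0 bound2 *.
  - by move/eqP: szD; rewrite eq_sym subn_eq0 leqNgt ltn.
  (* Here the maximum is [z], the point on which the last letter acts and which the first letter has
     produced: the pair wraps around. *)
  - have def_n : n = (size l).-1.
      by rewrite -[in RHS](subnK (ltnW ltn)) -szD.
    have def_l : l = take n l ++ [:: a] by rewrite -def_d cat_take_drop.
    case def_t: (take n l) => [|b l1] in def_l.
      by move: l_gt1; rewrite def_l.
    have bound1 := bound 1; exists a, b, (eval (l1 ++ [:: a]) z).
    split=> //=.
    - by right; exists l1; rewrite -cats1.
    - by rewrite -[in LHS]lz def_l.
    - by move: bound1; rewrite def_n Flast {1}def_l /= drop0.
  - exists a, b, (eval w z); split=> //.
    by left; exists (take n l), w; rewrite -def_d cat_take_drop.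
have [la lb] := cyclically_adjacent_In ab_adj.
have Kl' c : List.In c l -> letter c.
  elim: (l) Kl => //= d l0 IHl /andP[Kd Kl0] [<- //|]; exact: IHl.
(* Beyond [N], the point [F n] is unmarked for one of the two letters, so either [a] or the inverse
   of [b] would have to increase it. *)
have := NP _ la _ leNF _ lb (l_red _ _ ab_adj); rewrite negb_and => /orP[Qa|Qb].
  have /asboolP Ka := Kl' _ la.
  by have := K_incr Ka (l_nontriv _ la) Qa; rewrite ltnNge le_a.
case: b => y g in ab_adj Fn lb Qb *.
have [h [/asboolP Kh gK hK]] := letter_inv (Kl' _ lb).
have h_nontriv : h <> id.
  by move=> h1; apply: (l_nontriv _ lb); apply/funext=> i /=; rewrite -[RHS]gK h1.
by have := K_incr Kh h_nontriv Qb; rewrite Fn /= gK ltnNge -[g u]/((y, g).2 u) -Fn le_u.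
Qed.

(** Induction on the length: identity letters are deleted and cyclic neighbours from the same group
    are merged. What remains is a word of at most one letter or a cyclically reduced one. *)
Lemma eval_cofinitary l : all letter l -> cofinitary (eval l).
Proof.
have [n] := ubnP (size l); elim: n l => // n IHn l /ltnSE le_ln Kl.
have [[a [la a1]]|/forallNP nontriv] := EM (exists a, List.In a l /\ a.2 = id).
  have [l1 [l2 def_l]] := List.in_split _ _ la; rewrite def_l in le_ln Kl *.
  have -> : eval (l1 ++ a :: l2) = eval (l1 ++ l2).
    by apply/funext=> z; rewrite !eval_cat /= a1.
  apply: IHn; first by rewrite !size_cat /= addnS in le_ln *.
  by move: Kl; rewrite !all_cat /= => /and3P[-> _ ->].
have [[[x f] [[y g] [adj /= eq_xy]]]|/forallNP red] :=
  EM (exists a b, cyclically_adjacent l a b /\ a.1 = b.1).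
  rewrite -{y}eq_xy in adj; case: adj => [[l1 [l2 def_l]]|[l1 def_l]].
    rewrite def_l in le_ln Kl *.
    have -> : eval (l1 ++ (x, f) :: (x, g) :: l2) =
              eval (l1 ++ (x, comp f g) :: l2).
      by apply/funext=> z; rewrite !eval_cat.
    apply: IHn; first by rewrite !size_cat /= !addnS in le_ln *.
    move: Kl; rewrite !all_cat /= => /and4P[-> Kf Kg ->].
    by rewrite /= letter_comp.
  rewrite def_l in le_ln Kl *.
  move: Kl; rewrite /= all_rcons => /and3P[Kg Kf Kl1].
  have [h [_ fK _]] := letter_inv Kf.
  have -> : eval ((x, g) :: rcons l1 (x, f)) = comp (eval ((x, g) :: l1)) f.
    by apply/funext=> z; rewrite -cats1 -cat_cons eval_cat.
  (* The last letter moves to the front, where it merges with [g]. *)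
  apply: (cofinitary_swap fK).
  apply: (IHn ((x, comp f g) :: l1)); last by rewrite /= letter_comp.
  by rewrite /= size_rcons in le_ln *.
case: l => [|a [|b l]] in le_ln Kl nontriv red *; first by left.
  move: Kl; rewrite /= andbT => /asboolP /K_free [a1|[fix_free _]].
    by have := nontriv a; case; split; first by left.
  by right; exists 0 => z /fix_free.
right; apply: cyclically_reduced_fix => // [c lc c1|c d adj eq_cd].
  by apply: (nontriv c).
by have /forallNP := red c; apply; exact: conj adj eq_cd.
Qed.

Lemma generated_cofinitary : cofinitary_group generated.
Proof.
split; first exact: generated_subgroup.
by move=> f [l Kl ->]; apply: eval_cofinitary.
Qed.

End Generation.

(** * Almost disjoint branches *)

(* The number of steps along [x] at which the node [i] is reached, if any. *)
Definition branch (x : nat -> nat) (i : nat) : option nat :=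
  if pickle_inv i is Some s then
    if s == mkseq x (size s) then Some (size s) else None
  else None.

Lemma branchK x n : branch x (pickle (mkseq x n)) = Some n.
Proof. by rewrite /branch pickleK_inv size_mkseq eqxx. Qed.

Lemma branch_inv x i n : branch x i = Some n -> pickle (mkseq x n) = i.
Proof.
rewrite /branch; have := @pickle_invK (seq nat) i.
by case: (pickle_inv i) => //= s si; case: eqP => // def_s [<-]; rewrite -def_s.
Qed.

(** A common node codes a common prefix, whose length is at most any [k] with [x k <> y k]; only
    finitely many prefixes of [x] are that short. *)
Lemma branch_almost_disjoint x y : x <> y ->
  exists N, forall p, N <= p -> ~~ (branch x p && branch y p).
Proof.
move=> neq_xy; have [k neq_k] : exists k, x k <> y k.
  by apply/existsNP => eq_xy; apply/neq_xy/funext.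
exists (\max_(n < k.+1) pickle (mkseq x n)).+1 => p lt_p; apply/negP.
case Dx: (branch x p) => [n|//]; case Dy: (branch y p) => [m|//] _.
have def_p := branch_inv Dx.
have eq_s : mkseq x n = mkseq y m.
  by apply: (pcan_inj pickleK); rewrite def_p (branch_inv Dy).
have eq_nm : n = m by rewrite -(size_mkseq x n) eq_s size_mkseq.
have [lt_kn|le_nk] := ltnP k n.
  by apply: neq_k; rewrite -(nth_mkseq 0 x lt_kn) eq_s nth_mkseq // -eq_nm.
move: lt_p; rewrite ltnNge -def_p => /negP; apply.
exact: (leq_bigmax (Ordinal (le_nk : n < k.+1))).
Qed.

(** * Enumerating pairs with fresh second coordinates *)

Section Enumeration.

Variables (A : Type) (a0 : A) (c : A * nat -> nat).
Variables (d : nat -> A * nat) (q : nat -> option nat).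

Definition fresh (s : seq (A * nat)) : nat := (foldr maxn 0 (map snd s)).+1.

(** Where [q] is defined, the next required pair is listed unless already present; everywhere else a
    new second coordinate is opened. Codes under [c] make the membership test decidable. *)
Definition pick_next (i : nat) (s : seq (A * nat)) : A * nat :=
  if q i is Some n then
    if c (d n) \in map c s then (a0, fresh s) else d n
  else (a0, fresh s).

Fixpoint used (i : nat) : seq (A * nat) :=
  if i is j.+1 then pick_next j (used j) :: used j else [::].

Definition enumeration (i : nat) : A * nat := pick_next i (used i).

Lemma mem_used i v :
  reflect (exists2 j, j < i & v = c (enumeration j)) (v \in map c (used i)).
Proof.
apply: (iffP idP); elim: i => [|i IHi] //=.
- rewrite inE => /predU1P[->|/IHi[j lt_ji ->]]; first by exists i.
  by exists j; first exact: leqW.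
- by case.
- case=> j; rewrite ltnS leq_eqVlt inE => /predU1P[-> ->|lt_ji def_v].
    by rewrite eqxx.
  by rewrite IHi ?orbT //; exists j.
Qed.

Lemma lt_fresh i j : j < i -> (enumeration j).2 < fresh (used i).
Proof.
rewrite ltnS; elim: i => // i IHi; rewrite ltnS leq_eqVlt /= leq_max.
by case/predU1P=> [->|/IHi->]; rewrite ?leqnn ?orbT.
Qed.

Lemma enumeration_fresh i j :
  q i = None -> j < i -> (enumeration j).2 <> (enumeration i).2.
Proof.
by move=> qi /lt_fresh; rewrite {3}/enumeration /pick_next qi => /ltn_eqF/eqP.
Qed.

(** A newly listed pair either passed the test against the used codes or has a second coordinate
    above all used ones. *)
Lemma enumeration_inj : injective enumeration.
Proof.
have neq i j : j < i -> enumeration j <> enumeration i.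
  move=> lt_ji eq_m; have lt := lt_fresh lt_ji.
  have : c (enumeration j) \in map c (used i) by apply/mem_used; exists j.
  move: lt; rewrite eq_m /enumeration /pick_next.
  case: (q i) => [n|]; last by rewrite ltnn.
  by case: ifP => [_|-> //]; rewrite ltnn.
by move=> i j eq_m; case: (ltngtP i j) => // /neq; rewrite eq_m.
Qed.

Lemma enumeration_onto n : injective c ->
  (exists i, q i = Some n) -> exists i, enumeration i = d n.
Proof.
move=> c_inj [i qi]; have [/mem_used[j _ /c_inj ->]|unused] :=
  boolP (c (d n) \in map c (used i)); first by exists j.
by exists i; rewrite /enumeration /pick_next qi (negbTE unused).
Qed.

End Enumeration.

(** * Free actions that increase off a branch *)

Definition free_off_branch (x : nat -> nat) (K : (nat -> nat) -> Prop) : Prop :=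
  is_subgroup_Sym K /\
  forall f, K f -> f = id \/
    (forall i, f i <> i) /\ (forall i, ~~ branch x i -> i < f i).

(** The trivial group serves as the default for codes that no suitable group realizes. *)
Lemma free_off_branch1 x : free_off_branch x (fun f => f = id).
Proof.
split; last by left.
split; [by move=> f g /funext ->|split; [|split=> //; split]].
- by move=> f ->; split=> // m; exists m.
- by move=> f g -> ->.
- by move=> f ->; exists id.
Qed.

Lemma countable_retract (T : Type) (e : T) : countable_type T ->
  exists (c : T -> nat) (d : nat -> T), cancel c d.
Proof.
case=> c c_inj.
have [n|d dP] := choice (P := fun n s => forall t, c t = n -> s = t).
  have [[t <-]|/forallNP no_t] := EM (exists t, c t = n).
    by exists t => u /c_inj.
  by exists e => t /no_t.
by exists c, d => t; apply: dP.
Qed.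

(* Left translation on [T * nat], transported along an enumeration in which each
   [i] off the branch of [x] starts a new orbit. *)
Lemma regular_copy (T : Type) (mul : T -> T -> T) (inv : T -> T) (e : T)
    (x : nat -> nat) :
  is_group T mul inv e -> countable_type T ->
  exists phi : T -> nat -> nat,
    [/\ free_off_branch x (fun f => exists t, f = phi t),
        forall t u, phi (mul t u) = comp (phi t) (phi u) &
        injective phi].
Proof.
move=> [mulA [mul1 [mule [mulV mulVr]]]] /(countable_retract e)[c [d cK]].
pose c2 (p : T * nat) := pickle (c p.1, p.2).
pose d2 n := let p := odflt (0, 0) (unpickle n) in (d p.1, p.2).
have c2K : cancel c2 d2 by case=> t n; rewrite /d2 /c2 pickleK /= cK.
pose m := enumeration e c2 d2 (branch x).
have m_inj : injective m by apply: enumeration_inj.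
have [p|r rK] := choice (P := fun p i => m i = p).
  rewrite -(c2K p).
  apply: enumeration_onto; first exact: can_inj c2K.
  (* The branch has a node at every length, so [p] gets its turn at the node of length [c2 p]. *)
  by exists (pickle (mkseq x (c2 p))); apply: branchK.
have mK : cancel m r by move=> i; apply: m_inj; rewrite rK.
pose phi t i := r (mul t (m i).1, (m i).2).
have phiM t u : phi (mul t u) = comp (phi t) (phi u).
  by apply/funext=> i; rewrite /comp /phi rK /= mulA.
have phi1 : phi e = id.
  by apply/funext=> i; rewrite /phi mul1 -surjective_pairing mK.
have mul_eq1 t a : mul t a = a -> t = e.
  by move=> eq_a; rewrite -[t]mule -(mulVr a) mulA eq_a.
have phi_inj : injective phi.
  move=> t u eq_tu; have := congr1 (fun f => m (f (r (e, 0)))) eq_tu.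
  by rewrite /phi !rK /= !mule => -[].
have phiV t i : phi t (phi (inv t) i) = i /\ phi (inv t) (phi t i) = i.
  have /(congr1 (@^~ i)) := phiM (inv t) t; have /(congr1 (@^~ i)) := phiM t (inv t).
  by rewrite mulV mulVr phi1.
exists phi; split=> //; split.
- split; [by move=> f g /funext <-|split; [|split; [by exists e|split]]].
  + move=> _ [t ->]; split=> [i j|i].
      by move=> eq_ij; rewrite -[i](phiV t i).2 eq_ij (phiV t j).2.
    by exists (phi (inv t) i); rewrite (phiV t i).1.
  + by move=> _ _ [t ->] [u ->]; exists (mul t u).
  + move=> _ [t ->]; exists (phi (inv t)); split; first by exists (inv t).
    by split=> i; [apply: (phiV t i).1 | apply: (phiV t i).2].
- move=> _ [t ->]; have [->|t1] := EM (t = e); [by left | right].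
  have fix_free i : phi t i <> i.
    move/(congr1 m); rewrite /phi rK [RHS]surjective_pairing => -[/mul_eq1].
    by [].
  split=> // i br_i; rewrite ltnNge leq_eqVlt; apply/norP; split.
    exact/eqP/fix_free.
  (* Translation keeps the second coordinate, whereas off the branch that of [m i] differs from all
     earlier ones. *)
  apply/negP=> lt_i; have qi : branch x i = None by case: (branch x i) br_i.
  by apply: (enumeration_fresh (a0 := e) (c := c2) (d := d2) qi lt_i);
     rewrite -/m /phi rK.
Qed.

(** * A cofinitary group containing every countable group *)

(** Here [x] is read as a multiplication table on codes. Several numbers may code one element, so
    injectivity is only up to equality of rows. *)
Definition realizes (x : nat -> nat) (K : (nat -> nat) -> Prop) : Prop :=
  exists phi : nat -> nat -> nat,
    [/\ forall a, K (phi a),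
        forall a b : nat, phi (x (pickle (a, b))) = comp (phi a) (phi b) &
        forall a a', phi a = phi a' ->
          forall b : nat, x (pickle (a, b)) = x (pickle (a', b))].

(** Multiplication tables, rather than types, index the family: each table is assigned a group
    realizing it whenever a suitable one exists. *)
Lemma cofinitary_universal : exists G0 : (nat -> nat) -> Prop,
  cofinitary_group G0 /\
  forall (T : Type) (mul : T -> T -> T) (inv : T -> T) (e : T),
    is_group T mul inv e -> countable_type T -> embeds_into T mul G0.
Proof.
have [x|K KP] := choice (P := fun x K => free_off_branch x K /\
    ((exists K', free_off_branch x K' /\ realizes x K') -> realizes x K)).
  have [[K' [freeK' realK']]|none] :=
    EM (exists K', free_off_branch x K' /\ realizes x K'); first by exists K'.
  by exists (fun f => f = id); split; first exact: free_off_branch1.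
exists (generated K); split.
  exact: (generated_cofinitary (fun x => (KP x).1.1)
    (Q := fun x i => branch x i : bool)
    branch_almost_disjoint (fun x => (KP x).1.2)).
move=> T mul inv e grpT cntT; have [c [d cK]] := countable_retract e cntT.
pose x n := let p := odflt (0, 0) (unpickle n) in c (mul (d p.1) (d p.2)).
have xE a b : x (pickle (a, b)) = c (mul (d a) (d b)) by rewrite /x pickleK.
have [phi [freephi phiM phi_inj]] := regular_copy x grpT cntT.
have [|psi [Kpsi psiM psi_inj]] := (KP x).2.
  eexists; split; first exact: freephi.
  exists (fun a => phi (d a)); split=> [a|a b|a a' /phi_inj eq_d b].
  - by exists (d a).
  - by rewrite xE cK.
  - by rewrite !xE eq_d.
exists (fun t => psi (c t)); split; [|split].
- by move=> t; apply: generated_sub (Kpsi _).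
- by move=> t u n; rewrite -psiM xE !cK.
(* Equal rows agree in the column of [e], which holds the elements themselves. *)
- move=> t u /funext /psi_inj /(_ (c e)); rewrite !xE !cK => /(can_inj cK).
  by case: grpT => _ [_ [mule _]]; rewrite !mule.
Qed.

(** * Extension to a maximal cofinitary group *)

(** Any two elements of the union already lie in one member of the chain joined with [G0]. Adjoining
    [G0] throughout also covers the empty chain. *)
Lemma cofinitary_group_chain (F : set (set (nat -> nat))) G0 :
  cofinitary_group G0 -> (forall A, F A -> cofinitary_group (G0 `|` A)%classic) ->
  total_on F subset ->
  cofinitary_group (G0 `|` \bigcup_(A in F) A)%classic.
Proof.
move=> cofG0 cofF chainF; set U := (_ `|` _)%classic.
pose good B := cofinitary_group B /\ (B `<=` U)%classic.
have good0 : good G0 by split=> // f; left.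
have goodF A : F A -> good (G0 `|` A)%classic.
  move=> FA; split; first exact: cofF.
  by move=> f [|Af]; [left | right; exists A].
have good1 f : U f -> exists2 B, good B & B f.
  case=> [G0f|[A FA Af]]; first by exists G0.
  by exists (G0 `|` A)%classic; [apply: goodF | right].
have good2 f g : U f -> U g -> exists2 B, good B & B f /\ B g.
  move=> [G0f|[A FA Af]] [G0g|[B FB Bg]].
  - by exists G0.
  - by exists (G0 `|` B)%classic; [apply: goodF | split; [left|right]].
  - by exists (G0 `|` A)%classic; [apply: goodF | split; [right|left]].
  - have [AB|BA] := chainF _ _ FA FB.
      by exists (G0 `|` B)%classic; [apply: goodF | split; right=> //; apply: AB].
    by exists (G0 `|` A)%classic; [apply: goodF | split; right=> //; apply: BA].
split; last by move=> f /good1[B [[_ cofB] _] /cofB].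
split; [by move=> f g /funext <-|split; [|split; [|split]]].
- by move=> f /good1[B [[[_ [bijB _]] _] _] /bijB].
- by left; case: cofG0 => -[_ [_ []]].
- move=> f g Uf /(good2 _ _ Uf)[B [[[_ [_ [_ [BM _]]]] _] BU] [Bf Bg]].
  exact/BU/BM.
- move=> f /good1[B [[[_ [_ [_ [_ BV]]]] _] BU] /BV[h [Bh fhK]]].
  by exists h; split; first exact: BU.
Qed.

Lemma cofinitary_group_maximal_extension G0 : cofinitary_group G0 ->
  exists2 G, maximal_cofinitary_group G & forall f, G0 f -> G f.
Proof.
move=> cofG0; pose P (A : set (nat -> nat)) := cofinitary_group (G0 `|` A)%classic.
have [F FP chainF|A [PA maxA]] := @Zorn_bigcup _ P.
  exact: cofinitary_group_chain.
exists (G0 `|` A)%classic; last by left.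
split=> // H cofH GH f Hf; apply: contrapT => nGf.
(* As [H] contains [G0], it is itself a candidate, and [f] makes it strictly larger than [A]. *)
apply: (maxA H); last first.
  rewrite /P (_ : _ `|` H = H)%classic //; apply/seteqP; split=> g; last by right.
  by case=> // G0g; apply: GH; left.
split=> [g Ag|HA]; first by apply: GH; right.
by apply: nGf; right; apply: HA.
Qed.

Theorem mainTheorem12 :
  CH ->
  exists G : (nat -> nat) -> Prop,
    maximal_cofinitary_group G /\
    forall (T : Type) (mul : T -> T -> T) (inv : T -> T) (e : T),
      is_group T mul inv e -> countable_type T -> embeds_into T mul G.
Proof.
move=> _; have [G0 [cofG0 univG0]] := cofinitary_universal.
have [G maxG G0G] := cofinitary_group_maximal_extension cofG0.
exists G; split=> // T mul inv e grpT cntT.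
have [phi [G0phi phiP]] := univG0 T mul inv e grpT cntT.
by exists phi; split=> // t; apply: G0G.
Qed.
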